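(* Let $G$ be a group and let $K\unlhd G$ be a normal subgroup such that $G/K$ is finite. The following statements are equivalent: (a) $\mathcal B_K(G)$ is a seminormal C-monoid. (b) The class semigroup of $\mathcal B_K(G)$ in $\mathcal F(G)$ is Clifford. (c) The class semigroup of $\mathcal B(G/K)$ in $\mathcal F(G/K)$ is Clifford. (d) $\mathcal B(G/K)$ is a seminormal C-monoid. (e) $|(G/K)'|\le 2$, where $(G/K)'$ is the commutator subgroup of $G/K$.
   Context: Groups are written multiplicatively and need not be finite. $\mathcal F(G)$ is the free abelian monoid with basis (the set) $G$; its elements $S=g_1\boldsymbol{\cdot}\ldots\boldsymbol{\cdot} g_\ell$ are called sequences over $G$. The set of products is $\pi(S)=\{g_{\sigma(1)}\cdots g_{\sigma(\ell)}\in G:\sigma\text{ a permutation of }\{1,\dots,\ell\}\}$ (with $\pi=\{1_G\}$ for the empty sequence). For $K\unlhd G$, $\mathcal B_K(G)=\{S\in\mathcal F(G):\pi(S)\cap K\ne\emptyset\}$ is the monoid of product-$K$ sequences, and $\mathcal B(G)=\mathcal B_{\{1_G\}}(G)$ is the monoid of product-one sequences. A monoid is a commutative cancellative semigroup with identity; $H^\times$ is the group of units and $\mathsf q(H)$ the quotient group of $H$. The seminormal closure of $H$ is $H'=\{x\in\mathsf q(H):\text{there is }N\in\mathbb N\text{ such that }x^n\in H\text{ for all }n\ge N\}$, and $H$ is seminormal if $H=H'$. For monoids $H\subseteq F$ and $y,y'\in F$, put $y\sim_H y'$ iff for all $x\in F$: $yx\in H\Leftrightarrow y'x\in H$. Writing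 $[y]^F_H$ for the class of $y$, the class semigroup of $H$ in $F$ is $\mathcal C(H,F)=\{[y]^F_H:y\in F\}$ with operation $[x]^F_H+[y]^F_H=[xy]^F_H$; the reduced class semigroup is $\mathcal C^*(H,F)=\{[y]^F_H:y\in(F\setminus F^\times)\cup\{1\}\}$. $H$ is a C-monoid if it is a submonoid of a factorial monoid $F$ (one in which every element has a unique factorization into irreducibles up to order and associates) such that $H\cap F^\times=H^\times$ and $\mathcal C^*(H,F)$ is finite. A commutative semigroup is Clifford if it is a union of groups, i.e. each of its elements lies in a subsemigroup that is a group. *)

(* Defs.v *)
From HB Require Import structures.
From mathcomp Require Import all_boot all_order all_algebra.
From mathcomp Require Import finmap multiset.
From mathcomp Require Import boolp classical_sets functions cardinality.

Set Implicit Arguments.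
Unset Strict Implicit.
Unset Printing Implicit Defensive.

Import GRing.Theory.
Local Open Scope classical_set_scope.
Local Open Scope quotient_scope.
Local Open Scope ring_scope.

(* Commutative monoids are nmodTypes, so all monoids below (including the     *)
(* monoids of sequences over a multiplicative group) are written additively:  *)
(* the empty sequence is 0, concatenation is +, and x^n is x *+ n.            *)

HB.mixin Record isNormalClosed (G : groupType) (K : {pred G}) := {
  gpred_conj : forall x y : G, x \in K -> (x ^ y)%g \in K
}.

#[short(type="normalClosed")]
HB.structure Definition NormalClosed (G : groupType) :=
  {K of GroupClosed G K & isNormalClosed G K}.

Definition one_pred (G : groupType) : {pred G} := pred1 1%g.
Arguments one_pred : clear implicits.

Section OnePred.
Variable G : groupType.

Fact one_pred_mul : mulg_closed (one_pred G).
Proof. by move=> x y /eqP-> /eqP->; apply/eqP; rewrite mulg1. Qed.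
Fact one_pred_one : (1%g : G) \in one_pred G.
Proof. exact/eqP. Qed.
Fact one_pred_inv : invg_closed (one_pred G).
Proof. by move=> x /eqP->; apply/eqP; rewrite invg1. Qed.
Fact one_pred_conj (x y : G) : x \in one_pred G -> (x ^ y)%g \in one_pred G.
Proof. by move/eqP->; apply/eqP; rewrite conj1g. Qed.

HB.instance Definition _ := isMulClosed.Build G (one_pred G) one_pred_mul.
HB.instance Definition _ := isMul1Closed.Build G (one_pred G) one_pred_one.
HB.instance Definition _ := isInvClosed.Build G (one_pred G) one_pred_inv.
HB.instance Definition _ := isNormalClosed.Build G (one_pred G) one_pred_conj.
End OnePred.

Section QuotientGroup.
Variables (G : groupType) (K : normalClosed G).
Implicit Types x y z : G.

Definition coset_rel : rel G := fun x y => (x^-1 * y)%g \in K.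

Fact coset_rel_refl : reflexive coset_rel.
Proof. by move=> x; rewrite /coset_rel mulVg gpred1. Qed.
Fact coset_rel_sym : symmetric coset_rel.
Proof. by move=> x y; rewrite /coset_rel -gpredV invgM invgK. Qed.
Fact coset_rel_trans : transitive coset_rel.
Proof.
move=> y x z xy yz; rewrite /coset_rel.
rewrite (_ : x^-1 * z = (x^-1 * y) * (y^-1 * z))%g; first exact: gpredM.
by rewrite mulgA mulgK.
Qed.

Canonical coset_equiv :=
  EquivRel coset_rel coset_rel_refl coset_rel_sym coset_rel_trans.

Definition quotient_group := {eq_quot coset_equiv}.

HB.instance Definition _ := Choice.on quotient_group.
HB.instance Definition _ := EqQuotient.on quotient_group.

Implicit Types a b c : quotient_group.

Definition qg_one : quotient_group := \pi_quotient_group 1%g.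
Definition qg_mul a b : quotient_group := \pi_quotient_group (repr a * repr b)%g.
Definition qg_inv a : quotient_group := \pi_quotient_group (repr a)^-1%g.

Lemma qg_eqP x y : reflect (\pi_quotient_group x = \pi_quotient_group y)
                           ((x^-1 * y)%g \in K).
Proof. exact: eqquotP. Qed.

Lemma qg_mulE x y :
  qg_mul (\pi x) (\pi y) = \pi_quotient_group (x * y)%g.
Proof.
apply/qg_eqP; have /qg_eqP Hx := reprK (\pi_quotient_group x).
have /qg_eqP Hy := reprK (\pi_quotient_group y).
set x' := repr _ in Hx *; set y' := repr _ in Hy *.
rewrite (_ : _ * _ = (x'^-1 * x) ^ y' * (y'^-1 * y))%g.
  by rewrite gpredM ?gpred_conj.
by rewrite /conjg invgM !mulgA mulgK.
Qed.

Lemma qg_invE x : qg_inv (\pi x) = \pi_quotient_group x^-1%g.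
Proof.
apply/qg_eqP; have /qg_eqP := reprK (\pi_quotient_group x).
set x' := repr _ => Hx; rewrite invgK.
rewrite (_ : x' * _ = ((x'^-1 * x) ^ x'^-1)^-1)%g.
  by rewrite gpredV gpred_conj.
by rewrite /conjg invgK !mulgA mulgV mul1g invgM invgK.
Qed.

Fact qg_mulA : associative qg_mul.
Proof.
by elim/quotW=> x; elim/quotW=> y; elim/quotW=> z; rewrite !qg_mulE mulgA.
Qed.
Fact qg_mul1 : left_id qg_one qg_mul.
Proof. by elim/quotW=> x; rewrite qg_mulE mul1g. Qed.
Fact qg_mulr1 : right_id qg_one qg_mul.
Proof. by elim/quotW=> x; rewrite qg_mulE mulg1. Qed.
Fact qg_mulV : left_inverse qg_one qg_inv qg_mul.
Proof. by elim/quotW=> x; rewrite qg_invE qg_mulE mulVg. Qed.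
Fact qg_mulrV : right_inverse qg_one qg_inv qg_mul.
Proof. by elim/quotW=> x; rewrite qg_invE qg_mulE mulgV. Qed.

HB.instance Definition _ := isGroup.Build quotient_group
  qg_mulA qg_mul1 qg_mulr1 qg_mulV qg_mulrV.

End QuotientGroup.

Definition commutator_subgroup (G : groupType) : set G :=
  smallest (fun A => group_closed (mem A)) [set g | exists x y, g = [~ x, y]%g].
Arguments commutator_subgroup : clear implicits.

HB.mixin Record isCancellative V of GRing.Nmodule V := {
  cancel_addI : forall x : V, injective (+%R x)
}.

(* These are the "monoids" of the theory of C-monoids: commutative and        *)
(* cancellative.                                                              *)
#[short(type="cancelNmodType")]
HB.structure Definition CancelNmodule :=
  {V of isCancellative V & GRing.Nmodule V}.

Definition units (H : nmodType) : set H := [set x | exists y, x + y = 0].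
Arguments units : clear implicits.

Definition associated (H : nmodType) (x y : H) :=
  exists2 u, units H u & y = x + u.

Definition irreducible (H : nmodType) (x : H) :=
  ~ units H x /\ forall y z, x = y + z -> units H y \/ units H z.

Definition factorization (H : nmodType) (s : seq H) (x : H) :=
  (forall a, a \in s -> irreducible a) /\ associated (\sum_(a <- s) a) x.

(* A factorization of x is a list of irreducibles whose sum is associated to  *)
(* x, so that units have the empty factorization.                             *)
Definition factorial_monoid (H : nmodType) :=
  (forall x : H, exists s, factorization s x) /\
  (forall (x : H) s t, factorization s x -> factorization t x ->
     exists t', [/\ perm_eq t t', size s = size t'
       & forall i, (i < size s)%N -> associated s`_i t'`_i]).

Section GroupOfFractions.
Variable H : cancelNmodType.
Implicit Types p q r : H * H.

Definition frac_rel : rel (H * H) := fun p q => p.1 + q.2 == q.1 + p.2.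

Fact frac_rel_refl : reflexive frac_rel.
Proof. by move=> p; apply/eqP. Qed.
Fact frac_rel_sym : symmetric frac_rel.
Proof. by move=> p q; rewrite /frac_rel eq_sym. Qed.
Fact frac_rel_trans : transitive frac_rel.
Proof.
move=> q p r /eqP pq /eqP qr; apply/eqP; apply: (@cancel_addI _ q.2).
by rewrite addrA [q.2 + p.1]addrC pq addrAC qr [r.1 + q.2]addrC addrA.
Qed.

Canonical frac_equiv :=
  EquivRel frac_rel frac_rel_refl frac_rel_sym frac_rel_trans.

Definition fraction_group := {eq_quot frac_equiv}.

HB.instance Definition _ := Choice.on fraction_group.
HB.instance Definition _ := EqQuotient.on fraction_group.

Implicit Types a b c : fraction_group.

Definition fg_zero : fraction_group := \pi_fraction_group (0, 0).
Definition fg_add a b : fraction_group :=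
  \pi_fraction_group ((repr a).1 + (repr b).1, (repr a).2 + (repr b).2).
Definition fg_opp a : fraction_group := \pi_fraction_group ((repr a).2, (repr a).1).

Lemma fg_eqP p q : reflect (\pi_fraction_group p = \pi_fraction_group q)
                           (p.1 + q.2 == q.1 + p.2).
Proof. exact: eqquotP. Qed.

Lemma fg_addE p q :
  fg_add (\pi p) (\pi q) = \pi_fraction_group (p.1 + q.1, p.2 + q.2).
Proof.
apply/fg_eqP/eqP => /=.
have /fg_eqP/eqP Hp := reprK (\pi_fraction_group p).
have /fg_eqP/eqP Hq := reprK (\pi_fraction_group q).
by rewrite addrACA Hp Hq addrACA.
Qed.

Lemma fg_oppE p : fg_opp (\pi p) = \pi_fraction_group (p.2, p.1).
Proof.
apply/fg_eqP/eqP => /=; have /fg_eqP/eqP Hp := reprK (\pi_fraction_group p).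
by rewrite addrC -Hp addrC.
Qed.

Fact fg_addA : associative fg_add.
Proof.
by elim/quotW=> p; elim/quotW=> q; elim/quotW=> r; rewrite !fg_addE /= !addrA.
Qed.
Fact fg_addC : commutative fg_add.
Proof.
elim/quotW=> p; elim/quotW=> q; rewrite !fg_addE.
by rewrite [p.1 + _]addrC [p.2 + _]addrC.
Qed.
Fact fg_add0 : left_id fg_zero fg_add.
Proof. by elim/quotW=> -[p1 p2]; rewrite fg_addE /= !add0r. Qed.
Fact fg_addN : left_inverse fg_zero fg_opp fg_add.
Proof.
elim/quotW=> p; rewrite fg_oppE fg_addE; apply/fg_eqP/eqP => /=.
by rewrite addr0 add0r addrC.
Qed.

HB.instance Definition _ := GRing.isZmodule.Build fraction_group
  fg_addA fg_addC fg_add0 fg_addN.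

Definition to_fraction (x : H) : fraction_group := \pi_fraction_group (x, 0).

Definition seminormal_closure : set fraction_group :=
  [set x | exists N, forall n, (N <= n)%N -> range to_fraction (x *+ n)].

Definition seminormal := seminormal_closure = range to_fraction.

End GroupOfFractions.

Section ClassSemigroup.
Variables (F : nmodType) (H : set F).
Implicit Types x y z : F.

Definition class_rel : rel F :=
  fun y y' => `[< forall x, H (y + x) <-> H (y' + x) >].

Fact class_rel_refl : reflexive class_rel.
Proof. by move=> y; apply/asboolP. Qed.
Fact class_rel_sym : symmetric class_rel.
Proof. by move=> y z; apply/asboolP/asboolP => E x; rewrite E. Qed.
Fact class_rel_trans : transitive class_rel.
Proof. by move=> y x z /asboolP E1 /asboolP E2; apply/asboolP=> w; rewrite E1. Qed.

Canonical class_equiv :=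
  EquivRel class_rel class_rel_refl class_rel_sym class_rel_trans.

Definition class_semigroup := {eq_quot class_equiv}.

HB.instance Definition _ := Choice.on class_semigroup.
HB.instance Definition _ := EqQuotient.on class_semigroup.

Implicit Types a b c : class_semigroup.

Definition cs_zero : class_semigroup := \pi_class_semigroup 0.
Definition cs_add a b : class_semigroup := \pi_class_semigroup (repr a + repr b).

Lemma cs_eqP y y' : \pi_class_semigroup y = \pi_class_semigroup y' <->
                    (forall x, H (y + x) <-> H (y' + x)).
Proof. by split=> [/eqquotP/asboolP|E]; last exact/eqquotP/asboolP. Qed.

Lemma cs_addE x y : cs_add (\pi x) (\pi y) = \pi_class_semigroup (x + y).
Proof.
have /cs_eqP Hx := reprK (\pi_class_semigroup x).
have /cs_eqP Hy := reprK (\pi_class_semigroup y).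
apply/cs_eqP => z; rewrite -!addrA Hx.
by rewrite addrCA Hy addrCA.
Qed.

Fact cs_addA : associative cs_add.
Proof.
by elim/quotW=> x; elim/quotW=> y; elim/quotW=> z; rewrite !cs_addE addrA.
Qed.
Fact cs_addC : commutative cs_add.
Proof. by elim/quotW=> x; elim/quotW=> y; rewrite !cs_addE addrC. Qed.
Fact cs_add0 : left_id cs_zero cs_add.
Proof. by elim/quotW=> x; rewrite cs_addE add0r. Qed.

HB.instance Definition _ := GRing.isNmodule.Build class_semigroup
  cs_addA cs_addC cs_add0.

Definition reduced_class_semigroup : set class_semigroup :=
  [set \pi_class_semigroup y | y in ~` units F `|` [set 0]].

End ClassSemigroup.

(* C is (with the operation of S) a group; its identity e need not be the     *)
(* identity of S, should S have one.                                          *)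
Definition is_subgroup (S : baseAddMagmaType) (C : set S) :=
  (forall x y, C x -> C y -> C (x + y)) /\
  exists2 e, C e & forall x, C x ->
    e + x = x /\ exists2 y, C y & y + x = e.

Definition clifford (S : baseAddMagmaType) :=
  forall a : S, exists2 C : set S, is_subgroup C & C a.

(* "H is a submonoid of F" is rendered by an injective morphism H -> F.       *)
Definition C_monoid (H : cancelNmodType) :=
  exists (F : cancelNmodType) (f : {additive H -> F}),
    [/\ factorial_monoid F, injective f,
        range f `&` units F = f @` units H
      & finite_set (@reduced_class_semigroup F (range f))].

Notation "{ 'sequence' G }" := ({mset G}%mset)
  (at level 0, format "{ 'sequence'  G }").

Section FreeMonoid.
Variable T : choiceType.

Fact mset0D : left_id (mset0 : {sequence T}) (@msetD T).
Proof. by move=> A; rewrite msetDC msetD0. Qed.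

HB.instance Definition _ := Choice.copy {sequence T} {fsfun T -> nat with 0}.
HB.instance Definition _ := GRing.isNmodule.Build {sequence T}
  (@msetDA T) (@msetDC T) mset0D.

Fact msetD_inj (A : {sequence T}) : injective (+%R A).
Proof. exact: can_inj (msetDKB A). Qed.

HB.instance Definition _ := isCancellative.Build {sequence T} msetD_inj.
End FreeMonoid.

Definition products (G : groupType) (S : {sequence G}) : set G :=
  [set (\prod_(g <- s) g)%g | s in [set s : seq G | perm_eq s S]].

Section ProductSequences.
Variables (G : groupType) (K : normalClosed G).

Definition product_seq : {pred {sequence G}} :=
  fun S => `[< products S `&` [set` K] !=set0 >].

Fact product_seq_closed : GRing.nmod_closed product_seq.
Proof.
split.
  apply/asboolP; exists 1%g; split; last exact: gpred1.
  by exists [::]; [rewrite /= enum_mset0 | rewrite big_nil].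
move=> S T /asboolP[_ [[s sS <-] Ks]] /asboolP[_ [[t tT <-] Kt]].
apply/asboolP; exists (\prod_(g <- s ++ t) g)%g; split.
  exists (s ++ t) => //; apply/allP => x _; apply/eqP.
  rewrite /= count_cat (permP sS) (permP tT) !count_mem_mset.
  by rewrite /GRing.add /= msetE2.
by rewrite /= big_cat gpredM.
Qed.

HB.instance Definition _ :=
  GRing.isAddClosed.Build {sequence G} product_seq product_seq_closed.

Definition product_monoid := {S : {sequence G} | S \in product_seq}.

HB.instance Definition _ := SubChoice.on product_monoid.
HB.instance Definition _ := GRing.SubChoice_isSubNmodule.Build
  {sequence G} _ product_monoid product_seq_closed.

Fact product_monoid_inj (x : product_monoid) : injective (+%R x).
Proof.
move=> y z E; apply/val_inj/(@cancel_addI _ (val x)).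
by rewrite -!raddfD E.
Qed.

HB.instance Definition _ := isCancellative.Build product_monoid product_monoid_inj.

Definition product_class_semigroup :=
  @class_semigroup {sequence G} [set` product_seq].

End ProductSequences.

Definition product_one_monoid (G : groupType) := product_monoid (one_pred G).

HB.instance Definition _ (G : groupType) :=
  CancelNmodule.on (product_one_monoid G).

Definition product_one_class_semigroup (G : groupType) :=
  product_class_semigroup (one_pred G).

HB.instance Definition _ (G : groupType) (K : normalClosed G) :=
  GRing.Nmodule.on (product_class_semigroup K).
HB.instance Definition _ (G : groupType) :=
  GRing.Nmodule.on (product_one_class_semigroup G).

(* Main.v *)
Require Import Defs.
From mathcomp Require Import all_boot all_order all_algebra.
From mathcomp Require Import finmap multiset.
From mathcomp Require Import boolp classical_sets functions cardinality.
From mathcomp Require Import zify.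

(** Membership of a sequence over [G] in the monoid of product-[K] sequences
    depends only on the list of its images in the finite group [Q := G / K]: it
    asks whether that list can be reordered to have product 1 ([product_one]).
    Hence all five conditions can be read off from lists over [Q], and the ones
    about [G] and [K] are proved together with those about [G / K] by treating
    an arbitrary surjective colouring of the letters by [Q].  Two combinatorial
    conditions on [Q] are the hub of the proof:

    - [seminormal_lists Q]: a list is product-one as soon as all its large
      powers are; and
    - [unique_commutator Q]: any two nontrivial commutators are equal, which is
      the same as having a commutator subgroup of order at most 2.

    Seminormality of the monoid is the first condition, since a fraction with a
    power (of positive exponent) in the free monoid lies in the free monoid.

    Finiteness of the class semigroup holds without further conditions.  If a
    letter [g] occurs often enough in a list with product 1, the pigeonhole
    principle on prefix products gives factors with product 1 which begin with
    [g]; such factors can be moved around, so [o] copies of [g] can be taken out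
    of them, one from each, without changing the product, where [o] is an
    exponent of [Q] ([product_one_periodic]).  So the multiples of the class of a
    letter are eventually periodic, and finitely many of these classes generate.
    In particular the C-monoid property always holds, and a Clifford class
    semigroup forces seminormality: the class of [S] is then that of arbitrarily
    large multiples of [S].

    If nontrivial commutators are unique, they are central of order 2, and all
    reorderings of a list have one product up to that central element; both
    products occur unless the letters commute.  Therefore [s] and its power of
    exponent [o + 1] are in the same class, and the class semigroup is a union of
    cyclic groups.

    The main step is that seminormality forces uniqueness of the nontrivial
    commutator.  For a list [s], the products of the reorderings of the powers
    of [s] with exponent divisible by [o] form a group which contains the
    commutators of the letters and is normalised by the letters.  If it contains
    the product of [s], then all large powers of [s] are product-one, so [s] is.
    For [s = (g, h, (gh)^-1 c)], whose product is [c], only two cyclic orders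
    exist, so [c] is 1 or the commutator of [g] and [h]
    ([pair_power_product]).  Taking for [c] the inverse and a conjugate of that
    commutator shows that it has order 2 and commutes with [g]; so squares are
    central, and so are commutators, being products of squares.  Then the six
    cyclic orders of [(a, b, c, (abc)^-1 [~ a, c])] restrict the commutators of
    [a], [b], [c] enough to make any two nontrivial ones equal
    ([commg_triple], [commg_common]). *)

Set Implicit Arguments.
Unset Strict Implicit.
Unset Printing Implicit Defensive.

Import GRing.Theory.
Local Open Scope classical_set_scope.
Local Open Scope card_scope.
Local Open Scope quotient_scope.
Local Open Scope ring_scope.
Local Open Scope group_scope.

(** * Finite groups *)

Lemma finite_pigeonhole (T : Type) : finite_set [set: T] ->
  exists m, forall f : nat -> T,
    exists i j, [/\ (i < j)%N, (j <= m)%N & f i = f j].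
Proof.
case/finite_set_leP=> m /pcard_leP[g]; exists m => f.
have lt_gf i : (g (f i) < m)%N by exact: (@funS _ _ _ _ g (f i) I).
have [] := pselect (exists i j : 'I_m.+1, (i < j)%N /\ f i = f j).
  by move=> [i [j [ltij eqf]]]; exists i, j; split=> //; rewrite -ltnS.
move=> nex; pose h (i : 'I_m.+1) : 'I_m := Ordinal (lt_gf i).
suff /leq_card : injective h by rewrite !card_ord ltnn.
move=> i j [] /(@inj _ _ _ g) eqf; apply: val_inj => /=.
have {}eqf : f i = f j by apply: eqf; rewrite inE.
by case: (ltngtP i j) => // ltij; case: nex; [exists i, j|exists j, i].
Qed.

Lemma finite_group_exponent (Q : groupType) : finite_set [set: Q] ->
  exists2 o, (0 < o)%N & forall x : Q, x ^+ o = 1.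
Proof.
move=> /finite_pigeonhole[m fm]; exists m`!; first exact: fact_gt0.
move=> x; have [i [j [ltij lejm eqx]]] := fm (fun n => x ^+ n).
have /dvdnP[k ->] : (j - i %| m`!)%N by apply: dvdn_fact; lia.
rewrite mulnC expgnA expgnFr; last exact: ltnW.
by rewrite eqx mulgV expg1n.
Qed.

(** * Reordering lists *)

Lemma perm_cons_split (T : eqType) (x : T) s t : perm_eq t (x :: s) ->
  exists u v, t = u ++ x :: v /\ perm_eq (u ++ v) s.
Proof.
move=> ts; have : x \in t by rewrite (perm_mem ts) mem_head.
move=> xt; case/splitPr: xt ts => u v uv; exists u, v; split=> //.
by move: uv; rewrite -cat1s perm_catCA /= perm_cons.
Qed.

Lemma perm_eq_pair (T : eqType) (x y : T) t :
  perm_eq t [:: x; y] -> t = [:: x; y] \/ t = [:: y; x].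
Proof.
case/perm_cons_split=> u [v [-> /perm_small_eq-/(_ isT)]].
by case: u => [/= ->|? [|? ?] //= [-> ->]]; [left|right].
Qed.

Lemma perm_eq_triple (T : eqType) (a b c : T) t : perm_eq t [:: a; b; c] ->
  t \in [:: [:: a; b; c]; [:: b; a; c]; [:: b; c; a];
            [:: a; c; b]; [:: c; a; b]; [:: c; b; a]].
Proof.
case/perm_cons_split=> u [v [-> /perm_eq_pair[]]];
  case: u => [|? [|? [|? ?]]] /=;
  [move=> ->|case=> -> ->|case=> -> -> ->|by []|
   move=> ->|case=> -> ->|case=> -> -> ->|by []];
  by rewrite !inE eqxx ?orbT.
Qed.

(** The power of exponent [n] of [s] in the monoid of lists. *)
Definition copies (T : Type) n (s : seq T) := flatten (nseq n s).

Lemma count_copies T (a : pred T) n s : count a (copies n s) = (n * count a s)%N.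
Proof. by rewrite count_flatten map_nseq sumn_nseq mulnC. Qed.

Lemma mem_copies (T : eqType) n (s : seq T) : {subset copies n s <= s}.
Proof. by move=> x /flattenP[r /nseqP[-> _]]. Qed.

Lemma prod_copies (Q : groupType) n (s : seq Q) :
  \prod_(x <- copies n s) x = (\prod_(x <- s) x) ^+ n.
Proof.
by elim: n => [|n IH]; rewrite ?big_nil // [copies _ _]/= big_cat /= IH expgS.
Qed.

Lemma prod_nseq (Q : groupType) n (g : Q) : \prod_(x <- nseq n g) x = g ^+ n.
Proof. by elim: n => [|n IH]; rewrite ?big_nil //= big_cons IH expgS. Qed.

(** * Seminormality forces uniqueness of the nontrivial commutator *)

Section ProductOne.
Variable Q : groupType.
Implicit Types (s t u v w : seq Q) (x y g h c p q : Q).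

Definition product_one s := exists2 t, perm_eq t s & \prod_(x <- t) x = 1.

Lemma product_one_perm s t : perm_eq s t -> product_one s -> product_one t.
Proof. by move=> st [w ws w1]; exists w => //; apply: perm_trans st. Qed.

(** Having product 1 is invariant under rotation, so a chosen letter can be
    rotated to the end. *)
Lemma product_one_rcons s x : product_one (rcons s x) ->
  exists2 t, perm_eq t s & \prod_(y <- t) y = x^-1.
Proof.
case=> w; rewrite perm_sym perm_rcons perm_sym.
case/perm_cons_split=> u [v [-> uvs]]; rewrite big_cat big_cons /= => uxv.
exists (v ++ u); first by rewrite perm_catC.
rewrite big_cat /=; set U := \prod_(y <- u) y in uxv *.
set V := \prod_(y <- v) y in uxv *; apply: (@mulgI _ x); apply: (@mulgI _ U).
by rewrite !mulgA -(mulgA U x V) uxv mul1g mulgK.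
Qed.

Section Exponent.
Variable o : nat.
Hypothesis (o_gt0 : (0 < o)%N) (expo : forall x, x ^+ o = 1).

Lemma invg_expo x : x^-1 = x ^+ o.-1.
Proof. by apply: mulg1_eq; rewrite -expgS prednK. Qed.

(** The products of all reorderings of the powers of [s] with exponent divisible
    by [o]. Divisibility makes each such power contain 1 among its products,
    which is what turns this set into a group. *)
Definition power_product s : set Q :=
  [set p | exists m, exists2 t, perm_eq t (copies (m * o) s) &
                                \prod_(x <- t) x = p].

Lemma power_productM s p q :
  power_product s p -> power_product s q -> power_product s (p * q).
Proof.
move=> [m [t tm <-]] [n [u un <-]]; exists (m + n)%N, (t ++ u).
  apply/permP=> a; rewrite count_cat (permP tm) (permP un) !count_copies; nia.
by rewrite big_cat.
Qed.

Lemma power_productV s p : power_product s p -> power_product s p^-1.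
Proof.
move=> sp; rewrite invg_expo.
elim: (o.-1) => [|n IH]; last by rewrite expgS; apply: power_productM.
by exists 0%N, [::]; rewrite ?big_nil.
Qed.

(** Since a reordering of [s] can be chosen to begin with [x], the [o]-th power
    of that reordering is [x] followed by a list with product [x^-1]; the word
    for [p] is inserted in between. *)
Lemma power_productJ s x p : x \in s -> power_product s p ->
  power_product s (x * p * x^-1).
Proof.
move=> /perm_to_rem; set r := rem x s => sr [m [t tm <-]].
exists m.+1, (x :: t ++ r ++ copies o.-1 (x :: r)).
  apply/permP=> a; rewrite /= !count_cat (permP tm) !count_copies.
  rewrite (permP sr) /=; case: (o) o_gt0 => // k _; nia.
rewrite big_cons big_cat /= mulgA; congr (_ * _).
apply: (@mulgI _ x); rewrite mulgV big_cat prod_copies /= mulgA.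
have -> : x * \prod_(y <- r) y = \prod_(y <- x :: r) y by rewrite big_cons.
by rewrite -expgS prednK.
Qed.

(** One copy of [x y r] is followed by [o - 1] copies of [y x r], whose product
    is the inverse of that of [y x r]. *)
Lemma power_productR s x y r : perm_eq s [:: x, y & r] ->
  power_product s [~ x^-1, y^-1].
Proof.
move=> sr; exists 1%N, ([:: x, y & r] ++ copies o.-1 [:: y, x & r]).
  apply/permP=> a; rewrite count_cat !count_copies (permP sr) /=.
  by case: (o) o_gt0 => // k _; nia.
rewrite big_cat prod_copies /= -invg_expo !big_cons.
by rewrite !invgM !mulgA mulgK /commg /conjg !invgK !mulgA.
Qed.

(** With [P] the product of [s], reorder some copies so that they contribute
    [P ^+ k] with [k + n] divisible by [o], and leave the remaining ones, whose
    number is congruent to [n], in the order of [s]. *)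
Lemma power_product_eventually s : power_product s (\prod_(x <- s) x) ->
  exists N, forall n, (N <= n)%N -> product_one (copies n s).
Proof.
move=> [m [t tm eqts]]; exists (o * (m * o))%N => n leNn.
pose k := (o - n %% o)%N.
have ltno : (n %% o < o)%N by rewrite ltn_mod.
have leko : (k * (m * o) <= o * (m * o))%N by rewrite leq_mul2r leq_subr orbT.
exists (copies k t ++ copies (n - k * (m * o)) s).
  apply/permP=> a; rewrite count_cat !count_copies (permP tm) count_copies.
  rewrite mulnA -mulnDl subnKC //; exact: leq_trans leNn.
rewrite big_cat /= !prod_copies eqts -expgnDr.
set P := \prod_(x <- s) x.
have Pmul j : P ^+ (j * o) = 1 by rewrite mulnC expgnA expo expg1n.
rewrite -[LHS]mulg1 -(Pmul (k * m)%N) -expgnDr.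
rewrite (_ : _ + _ = (n %/ o).+1 * o)%N ?Pmul //.
have := divn_eq n o; rewrite /k; nia.
Qed.

Definition seminormal_lists := forall s,
  (exists N, forall n, (N <= n)%N -> product_one (copies n s)) -> product_one s.

Hypothesis SN : seminormal_lists.

Lemma power_product_product_one s p : p = \prod_(x <- s) x ->
  power_product s p -> product_one s.
Proof. by move=> -> /power_product_eventually/SN. Qed.

(** Up to rotation the three letters have only two orders. *)
Lemma pair_power_product g h c :
  power_product [:: g; h; (g * h)^-1 * c] c -> c = 1 \/ c = [~ g^-1, h^-1].
Proof.
set x := (g * h)^-1 * c => spc.
have /power_product_product_one : c = \prod_(y <- [:: g; h; x]) y.
  by rewrite !big_cons big_nil mulg1 mulgA mulVKg.
move=> /(_ spc)/(@product_one_rcons [:: g; h])[t].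
case/perm_eq_pair=> ->; rewrite invgM invgK !big_cons big_nil mulg1 => eqc.
  by left; move: eqc; rewrite -[LHS]mul1g => /mulIg/esym/eqP;
    rewrite invg_eq1 => /eqP.
right; apply: (@mulIg _ (h * g)); rewrite -commgCV eqc.
by rewrite mulVKg.
Qed.

(** The value [c] of [pair_power_product] may be taken to be the inverse of the
    commutator, or its conjugate by [g]. *)
Lemma commg_sqr_commute g h :
  [~ g, h] ^+ 2 = 1 /\ commute [~ g, h] g.
Proof.
rewrite -[g]invgK -[h]invgK; move: g^-1 h^-1 => g' h'.
set y := [~ _, _].
have yE : power_product [:: g'; h'; (g' * h')^-1 * y^-1] y.
  exact: power_productR (perm_refl _).
have y2 : y * y = 1.
  have [/eqP|eqy] := pair_power_product (power_productV yE).
    by rewrite invg_eq1 => /eqP->; rewrite mulg1.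
  by have := mulVg y; rewrite eqy.
split=> //.
have {yE}: power_product [:: g'; h'; (g' * h')^-1 * (g' * y * g'^-1)]
                     (g' * y * g'^-1).
  apply: power_productJ; first exact: mem_head.
  exact: power_productR (perm_refl _).
move/pair_power_product => [/eqP|/(congr1 (fun z => z * g'))].
  rewrite mulg_eq1 invgK -[X in _ == X]mulg1.
  by move/eqP/mulgI=> ->; apply/commute_sym/commute1.
by rewrite mulgVK => eqy; apply: commuteV; rewrite /commute -/y eqy.
Qed.

(** Squares are central because the commutator of [y] and [z] has order 2 and
    commutes with [y]; and every commutator is a product of three squares. *)
Lemma commg_central g h x : commute [~ g, h] x.
Proof.
have sqC y z : commute (y ^+ 2) z.
  apply/commgP; rewrite -conjg_fix conjXg.
  have [y2 yC] := commg_sqr_commute y z.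
  rewrite (_ : y ^ z = y * [~ y, z]); last by rewrite commgEl mulVKg.
  by rewrite expgMn ?y2 ?mulg1 //; apply: commute_sym.
rewrite (_ : [~ g, h] = (g^-1) ^+ 2 * (g * h^-1) ^+ 2 * h ^+ 2).
  by apply/commute_sym/commuteM; first apply: commuteM;
    apply/commute_sym/sqC.
by rewrite /commg /conjg !expg2 !mulgA !mulgVK.
Qed.

Let commC g h x : [~ g, h] * x = x * [~ g, h].
Proof. exact: commg_central. Qed.

Let comm2 g h : [~ g, h] * [~ g, h] = 1.
Proof. by have [] := commg_sqr_commute g h. Qed.

Let commS g h : [~ g, h] = [~ h, g].
Proof. by rewrite -[RHS]mul1g -(comm2 g h) -mulgA -(invgR g) mulgV mulg1. Qed.

Let commVV g h : [~ g^-1, h^-1] = [~ g, h].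
Proof. by apply: (@mulIg _ (h * g)); rewrite -commgCV commgC commC. Qed.

Let commMl g h x : [~ g * h, x] = [~ g, x] * [~ h, x].
Proof.
apply: (@mulgI _ (x * (g * h))); rewrite -commgC.
move: (commgC g x) (commgC h x) (commC g x h).
move: [~ g, x] [~ h, x] => k l gx hx kh.
by rewrite -(mulgA g) hx !mulgA gx -(mulgA _ k h) kh !mulgA.
Qed.

Let commMr g h x : [~ x, g * h] = [~ x, g] * [~ x, h].
Proof. by rewrite commS commMl !(commS x). Qed.

(** Write [al], [be], [ga] for the commutators of [(a, b)], [(a, c)], [(b, c)].
    The list [(a, b, c, (abc)^-1 be)] has product [be], which belongs to
    its [power_product]; hence some order of [a, b, c] has product
    [be * (a * b * c)]. The six orders have products [k * (a * b * c)] with [k] equal to 1, [al],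
    [be * al], [ga], [be * ga] or [ga * be * al]. *)
Lemma commg_triple a b c :
  [~ a, b] != 1 -> [~ a, c] != 1 -> [~ a, b] != [~ a, c] ->
  [\/ [~ b, c] = 1, [~ b, c] = [~ a, b] | [~ b, c] = [~ a, c]].
Proof.
set al := [~ a, b]; set be := [~ a, c]; set ga := [~ b, c] => al1 be1 alNbe.
have [t tabc tE] : exists2 t, perm_eq t [:: a; b; c] &
                              \prod_(y <- t) y = be * (a * b * c).
  pose x := (a * b * c)^-1 * be.
  have : product_one (rcons [:: a; b; c] x).
    apply: (@power_product_product_one _ be).
      by rewrite !big_cons big_nil mulg1 (mulgA b) (mulgA a) (mulgA a b) mulVKg.
    rewrite /be -commVV; apply: (@power_productR _ _ _ [:: b; x]).
    by rewrite /= perm_cons (permEl (perm_catCA [:: b] [:: c] [:: x])).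
  case/product_one_rcons=> t tabc tE; exists t => //; rewrite tE.
  by rewrite /x invgM invgK (mulg1_eq (comm2 a c)).
have ba : b * a = al * (a * b) by rewrite commC /al commS -commgC.
have ca : c * a = be * (a * c) by rewrite commC /be commS -commgC.
have cb : c * b = ga * (b * c) by rewrite commC /ga commS -commgC.
have alC x y : x * (al * y) = al * (x * y).
  by rewrite (mulgA x) -(commC a b x) -(mulgA _ x).
have beC x y : x * (be * y) = be * (x * y).
  by rewrite (mulgA x) -(commC a c x) -(mulgA _ x).
have gaC x y : x * (ga * y) = ga * (x * y).
  by rewrite (mulgA x) -(commC b c x) -(mulgA _ x).
have ga2 : ga * ga = 1 by apply: comm2.
(* Rewriting with associativity must not see through these commutators. *)
clearbody al be ga.
have {tE} : be = 1 \/ be = al \/ be = be * al \/ be = ga \/ be = be * ga \/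
            be = ga * be * al.
  have cancel k : \prod_(y <- t) y = k * (a * b * c) -> be = k.
    by rewrite tE => /mulIg.
  have := perm_eq_triple tabc.
  rewrite !inE => /or4P[|||/or3P[]] /eqP te;
    rewrite te !big_cons big_nil mulg1 in cancel.
  - by left; apply: cancel; rewrite mul1g mulgA.
  - by right; left; apply: cancel; rewrite mulgA ba -!mulgA.
  - do 2 right; left; apply: cancel; rewrite ca beC (mulgA b) ba.
    by rewrite !mulgA.
  - do 3 right; left; apply: cancel; rewrite cb gaC.
    by rewrite !mulgA.
  - do 4 right; left; apply: cancel; rewrite mulgA ca -!mulgA cb gaC.
    by rewrite !mulgA.
  - do 5 right; apply: cancel; rewrite mulgA cb -!mulgA ca beC (mulgA b) ba.
    by rewrite !mulgA.
case=> [|[|[|[|[]]]]].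
- by move=> be0; rewrite be0 eqxx in be1.
- by move=> eqba; rewrite eqba eqxx in alNbe.
- by rewrite -{1}[be]mulg1 => /mulgI al0; rewrite -al0 eqxx in al1.
- by constructor 3.
- by rewrite -{1}[be]mulg1 => /mulgI <-; constructor 1.
- rewrite -mulgA beC -{1}[be]mulg1 => /mulgI gaal; constructor 2.
  by apply: (@mulgI _ ga); rewrite ga2 -gaal.
Qed.

(** If the commutators [al] of [(a, b)] and [be] of [(a, c)] were distinct, then
    [commg_triple] would confine [ga], the commutator of [(b, c)], to 1, [al] and
    [be]. Replacing [b] by [b * a], or [c] by [c * a], or both, keeps [al] and
    [be] and multiplies [ga] by [be], [al] or [al * be]; one of these values lies
    outside the three allowed ones. *)
Lemma commg_common a b c :
  [~ a, b] != 1 -> [~ a, c] != 1 -> [~ a, b] = [~ a, c].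
Proof.
move=> al1 be1; apply/eqP/negPn/negP => alNbe.
have alNbe1 : [~ a, b] * [~ a, c] != 1.
  by rewrite mulg_eq1 invgR -commS.
have tri1 := commg_triple al1 be1 alNbe.
have aba : [~ a, b * a] = [~ a, b] by rewrite commMr commgg mulg1.
have aca : [~ a, c * a] = [~ a, c] by rewrite commMr commgg mulg1.
have tri2 : [\/ [~ b, c] * [~ a, c] = 1, [~ b, c] * [~ a, c] = [~ a, b]
             | [~ b, c] * [~ a, c] = [~ a, c]].
  by rewrite -commMl -{1}aba; apply: commg_triple; rewrite ?aba.
have tri3 : [\/ [~ b, c] * [~ a, b] = 1, [~ b, c] * [~ a, b] = [~ a, b]
             | [~ b, c] * [~ a, b] = [~ a, c]].
  by rewrite (commS a b) -commMr -(commS a b) -{1}aca; apply: commg_triple;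
    rewrite ?aca.
have tri4 : [\/ [~ b, c] * ([~ a, b] * [~ a, c]) = 1,
                [~ b, c] * ([~ a, b] * [~ a, c]) = [~ a, b]
             | [~ b, c] * ([~ a, b] * [~ a, c]) = [~ a, c]].
  have -> : [~ b, c] * ([~ a, b] * [~ a, c]) = [~ b * a, c * a].
    rewrite commMr !commMl commgg mulg1 (commS b a) -(commC a c [~ a, b]).
    by rewrite (mulgA [~ b, c]).
  by rewrite -{1}aba -{1}aca; apply: commg_triple; rewrite ?aba ?aca.
move: (commC a b [~ a, c]) al1 be1 alNbe alNbe1 tri1 tri2 tri3 tri4.
move: [~ a, b] [~ a, c] [~ b, c] => al be ga C al1 be1 alNbe alNbe1.
have key : ~ [\/ al * be = 1, al * be = al | al * be = be].
  case=> /eqP; first exact/negP.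
    by rewrite -{2}[al]mulg1 => /eqP/mulgI/eqP; apply/negP.
  by rewrite -{2}[be]mul1g => /eqP/mulIg/eqP; apply/negP.
case=> gaE; rewrite {}gaE => tri2 tri3 tri4.
- by apply: key; move: tri4; rewrite mul1g.
- exact: key.
- by apply: key; rewrite C.
Qed.

(** If some letter of one pair does not commute with some letter of the other,
    two applications of [commg_common] suffice. Otherwise [b * c] has the
    commutators of [b] with [a] and of [c] with [d], and serves as a common
    letter. *)
Lemma commg_unique a b c d :
  [~ a, b] != 1 -> [~ c, d] != 1 -> [~ a, b] = [~ c, d].
Proof.
move=> ab1 cd1.
have [ac1|ac1] := eqVneq [~ a, c] 1; last first.
  rewrite (commg_common ab1 ac1) (commS a c); apply: commg_common => //.
  by rewrite -(commS a c).
have [bd1|bd1] := eqVneq [~ b, d] 1; last first.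
  transitivity [~ b, d].
    by rewrite (commS a b); apply: commg_common; rewrite // -(commS a b).
  rewrite (commS b d) (commS c d).
  by apply: commg_common; rewrite -?(commS b d) -?(commS c d).
have [bc1|bc1] := eqVneq [~ b, c] 1; last first.
  transitivity [~ b, c].
    by rewrite (commS a b); apply: commg_common; rewrite // -(commS a b).
  by rewrite (commS b c); apply: commg_common; rewrite -?(commS b c).
have abcE : [~ a, b * c] = [~ a, b] by rewrite commMr ac1 mulg1.
have bcdE : [~ b * c, d] = [~ c, d] by rewrite commMl bd1 mul1g.
rewrite -abcE -bcdE (commS a); apply: commg_common; rewrite ?bcdE //.
by rewrite -(commS a) abcE.
Qed.

End Exponent.

End ProductOne.

Definition unique_commutator (Q : groupType) := forall a b c d : Q,
  [~ a, b] != 1 -> [~ c, d] != 1 -> [~ a, b] = [~ c, d].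

Lemma seminormal_lists_unique_commutator (Q : groupType) :
  finite_set [set: Q] -> seminormal_lists Q -> unique_commutator Q.
Proof.
move=> /finite_group_exponent[o o_gt0 expo] SN a b c d.
exact: (commg_unique o_gt0 expo SN).
Qed.

(** * Groups with a unique nontrivial commutator *)

Section PermProducts.
Variables (Q : groupType) (Z : set Q).
Hypotheses (Z1 : Z 1) (ZM : forall x y, Z x -> Z y -> Z (x * y)).
Hypothesis ZC : forall z x, Z z -> commute z x.

(** Moving a letter across another one costs a commutator, which is central and
    can be collected in front. *)
Lemma prod_perm (s t : seq Q) :
  (forall x y, x \in s -> y \in s -> Z [~ x, y]) -> perm_eq t s ->
  exists2 z, Z z & \prod_(x <- t) x = z * \prod_(x <- s) x.
Proof.
elim: s t => [|x s IH] t Zs.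
  by move/perm_nilP->; exists 1; rewrite ?mul1g.
case/perm_cons_split=> u [v [-> uvs]].
have [||z1 Zz1 uvE] := IH (u ++ v) => //.
  by move=> y y' sy sy'; apply: Zs; rewrite in_cons ?sy ?sy' orbT.
have us : {subset u <= s}.
  by move=> y uy; rewrite -(perm_mem uvs) mem_cat uy.
have [z2 Zz2 uE] : exists2 z, Z z &
    (\prod_(y <- u) y) * x = z * (x * \prod_(y <- u) y).
  elim: u us {uvs uvE} => [|y u IHu] us.
    by exists 1; rewrite // big_nil !(mul1g, mulg1).
  have [|z Zz uE] := IHu; first by move=> w uw; apply/us/mem_behead.
  have Zyx : Z [~ y, x].
    by apply: Zs; rewrite ?mem_head // in_cons us ?mem_head ?orbT.
  exists ([~ y, x] * z); first exact: ZM.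
  rewrite big_cons -mulgA uE.
  move: (commgC y x) (@ZC _ (x * y) Zyx) (@ZC _ z Zyx) (@ZC _ y Zz).
  move: [~ y, x] (\prod_(y <- u) y) => k U yx kxy kz zy.
  by rewrite (mulgA y) -zy -(mulgA z) (mulgA y x) yx -kxy kz !mulgA.
exists (z2 * z1); first exact: ZM.
rewrite big_cat !big_cons /= mulgA uE -(mulgA z2) -(mulgA x).
move: uvE; rewrite big_cat /= => ->.
by rewrite (mulgA x) -(@ZC _ x Zz1) !mulgA.
Qed.

End PermProducts.

Section UniqueCommutator.
Variables (Q : groupType) (o : nat).
Hypotheses (UQ : unique_commutator Q) (expo : forall x : Q, x ^+ o = 1).

(** The set of commutators is already a subgroup here: its nontrivial elements
    are all equal, hence equal to their inverses and conjugates. *)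
Let Z : set Q := [set [~ x, y] | x in [set: Q] & y in [set: Q]].

Let ZR x y : Z [~ x, y]. Proof. by exists x => //; exists y. Qed.

Let Z1 : Z 1. Proof. by rewrite -(commg1 1). Qed.

Let Z_eq p q : Z p -> Z q -> p != 1 -> q != 1 -> p = q.
Proof. by move=> [a _ [b _ <-]] [c _ [d _ <-]]; apply: UQ. Qed.

Let Z_sqr z : Z z -> z * z = 1.
Proof.
have [->|z1] := eqVneq z 1; first by rewrite mulg1.
move=> Zz; have Zz' : Z z^-1 by case: Zz => a _ [b _ <-]; rewrite invgR.
by rewrite -{1}(Z_eq Zz' Zz) ?mulVg ?invg_eq1.
Qed.

Let ZM x y : Z x -> Z y -> Z (x * y).
Proof.
have [->|x1] := eqVneq x 1; first by rewrite mul1g.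
have [->|y1] := eqVneq y 1; first by rewrite mulg1.
by move=> Zx Zy; rewrite (Z_eq Zx Zy) // Z_sqr.
Qed.

Let ZC z x : Z z -> commute z x.
Proof.
have [->|z1 Zz] := eqVneq z 1; first by move=> _; apply/commute_sym/commute1.
apply/commgP; rewrite -conjg_fix; apply/eqP/Z_eq; rewrite ?conjg_eq1 //.
by case: Zz => a _ [b _ <-]; rewrite conjRg.
Qed.

(** By the choice of [o] the two lists have the same product as written. If a
    reordering of the first has product 1 but this common product is some
    [z != 1], then not all letters commute, and exchanging two letters which do
    not commute multiplies the product of a reordering of [s ++ t] by [z]. *)
Lemma product_one_copies (s t : seq Q) :
  product_one (copies o.+1 s ++ t) <-> product_one (s ++ t).
Proof.
split=> [[w wst w1]|[w wst w1]]; last first.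
  exists (copies o s ++ w); last by rewrite big_cat prod_copies /= w1 expo mulg1.
  apply/permP => a; rewrite !count_cat !count_copies (permP wst) count_cat; lia.
have wst_prod : \prod_(x <- copies o.+1 s ++ t) x = \prod_(x <- s ++ t) x.
  by rewrite !big_cat prod_copies expo /= mulg1.
have sub : {subset copies o.+1 s ++ t <= s ++ t}.
  by move=> x; rewrite (mem_cat x s) (mem_cat _ (copies _ _)) =>
    /orP[/mem_copies->|->]; rewrite ?orbT.
have [z Zz] := prod_perm Z1 ZM ZC (fun x y _ _ => ZR x y) wst.
rewrite w1 wst_prod => zst.
have [z1|z1] := eqVneq z 1.
  by exists (s ++ t); move: zst; rewrite // z1 mul1g => <-.
have zE : \prod_(x <- s ++ t) x = z.
  by apply: (@mulgI _ z); rewrite -zst Z_sqr.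
pose comm (x y : Q) := [~ x, y] == 1.
have [/allrelP cst|] := boolP (allrel comm (s ++ t) (s ++ t)).
  have [|||x y sx sy|_ -> zst'] := @prod_perm _ [set 1] _ _ _ _ _ _ wst.
  - by [].
  - by move=> x y /= -> ->; rewrite mulg1.
  - by move=> y x /= ->; apply/commute_sym/commute1.
  - by apply/eqP/cst; apply: sub.
  - by move: zst'; rewrite w1 mul1g wst_prod zE => z1'; rewrite -z1' eqxx in z1.
case/allPn=> x xst /allPn[y yst xy].
have [r str] : exists r, perm_eq [:: x, y & r] (s ++ t).
  have yx : y != x by apply: contraNneq xy => ->; rewrite /comm commgg.
  exists (rem y (rem x (s ++ t))); rewrite perm_sym.
  apply: (perm_trans (perm_to_rem xst)); rewrite perm_cons perm_to_rem //.
  by rewrite (rem_mem yx).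
have [z' Zz'] := prod_perm Z1 ZM ZC (fun x y _ _ => ZR x y) str.
have [-> xyr|z'1 xyr] := eqVneq z' 1; last first.
  by exists [:: x, y & r]; rewrite // xyr zE (Z_eq Zz' Zz) // Z_sqr.
exists [:: y, x & r].
  by rewrite -(permPr str) (permEl (perm_catCA [:: y] [:: x] r)).
apply: (@mulgI _ z); rewrite mulg1 -zE -[RHS]mul1g -xyr !big_cons !mulgA.
rewrite zE (Z_eq Zz (ZR x y)) // (commgC x y) -(ZC (y * x) (ZR x y)).
by rewrite !mulgA.
Qed.

Lemma commutator_subgroup_card : commutator_subgroup Q #<= `I_2.
Proof.
have sub : commutator_subgroup Q `<=` Z.
  apply: smallest_sub => [|_ [x [y ->]]]; last exact: ZR.
  split=> [|x y]; first by rewrite in_setE; apply: Z1.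
  rewrite !in_setE => Zx Zy; rewrite (mulg1_eq (Z_sqr Zy)); exact: ZM.
apply: card_le_trans (subset_card_le sub) _.
have [[z [Zz z1]]|noz] := pselect (exists z, Z z /\ z != 1).
  apply: card_le_trans (card_image_le (fun k => if k == 0%N then 1 else z) _).
  apply: subset_card_le => x Zx; have [->|x1] := eqVneq x 1.
    by exists 0%N.
  by exists 1%N => //=; apply: Z_eq.
apply: card_le_trans (card_image_le (fun=> 1 : Q) _).
apply: subset_card_le => x Zx; exists 0%N => //; apply/esym/eqP.
by apply: contra_notT noz => x1; exists x.
Qed.

End UniqueCommutator.

(** * Periodicity of powers of a letter *)

Section Periodicity.
Variable Q : groupType.
Hypothesis finQ : finite_set [set: Q].

(** Pigeonhole on the products of the prefixes that end just before an occurrence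
    of [g]. The bound on the occurrences used up by the factor is what allows
    the extraction to be repeated. *)
Lemma product_one_factor : exists m, forall (g : Q) w, (m < count_mem g w)%N ->
  exists u v t, [/\ w = u ++ g :: v ++ t, \prod_(x <- g :: v) x = 1 &
                   (count_mem g (g :: v) <= m)%N].
Proof.
have [m pm] := finite_pigeonhole finQ; exists m => g w ltmw.
(* [u k] is the prefix that ends just before occurrence number [k] of [g]. *)
have /choice[u uP] : forall k, exists u, (k < count_mem g w)%N ->
    exists v, w = u ++ g :: v /\ count_mem g u = k.
  elim: w {ltmw} => [|x w IH] k; first by exists [::].
  have [->|xg] := eqVneq x g; rewrite /= ?eqxx ?(negPf xg) ?add0n ?add1n;
    last first.
    have [u uP] := IH k; exists (x :: u) => /uP[v [-> uk]].
    by exists v; rewrite /= (negPf xg).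
  case: k => [|k]; first by exists [::] => _; exists w.
  have [u uP] := IH k; exists (g :: u); rewrite ltnS => /uP[v [-> uk]].
  by exists v; rewrite /= eqxx uk.
have [i [j [ltij lejm eqij]]] := pm (fun k => \prod_(x <- u k) x).
have [|v [wi ci]] := uP i; first by lia.
have [|v' [wj cj]] := uP j; first by lia.
have lt_ij : (size (u i) < size (u j))%N.
  rewrite ltnNge; apply/negP => le_ji.
  suff : (count_mem g (u j) <= count_mem g (u i))%N by lia.
  have ujE : u j = take (size (u j)) (u i).
    by rewrite -[LHS](take_size_cat (g :: v') erefl) -wj wi takel_cat.
  rewrite -[X in (_ <= count_mem g X)%N](cat_take_drop (size (u j)) (u i)).
  by rewrite count_cat -ujE leq_addr.
pose k := (size (u j) - size (u i)).-1.
have ujE : u j = u i ++ g :: take k v.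
  rewrite -[LHS](take_size_cat (g :: v') erefl) -wj wi take_cat.
  by rewrite ltnNge (ltnW lt_ij) /= -[(_ - _)%N]prednK ?subn_gt0.
exists (u i), (take k v), (drop k v); split; first by rewrite cat_take_drop.
  by apply: (@mulgI _ (\prod_(x <- u i) x)); rewrite mulg1 [RHS]eqij ujE big_cat.
have := cj; rewrite ujE count_cat ci; lia.
Qed.

(** From a product-one list with many letters [g], extract [o] factors [g v_i]
    with product 1. The rest still has product 1, and the [v_i] have product
    [g^-1] each, hence 1 together; so the [o] letters [g] can be dropped. *)
Lemma product_one_periodic : exists L o, (0 < o)%N /\ forall (g : Q) t,
  product_one (nseq (L + o) g ++ t) <-> product_one (nseq L g ++ t).
Proof.
have [m pm] := product_one_factor.
have [o o_gt0 expo] := finite_group_exponent finQ.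
exists (o * m).+1, o; split=> // g t; split=> [pt|[w wt w1]]; last first.
  exists (nseq o g ++ w); last by rewrite big_cat prod_nseq /= expo w1 mulg1.
  by rewrite addnC nseqD -catA perm_cat2l.
have [w wt w1] := pt.
have peel k : (k <= o)%N -> exists v r,
    [/\ perm_eq w (nseq k g ++ v ++ r),
        \prod_(x <- v) x = g^-1 ^+ k, \prod_(x <- r) x = 1 &
        ((o - k) * m < count_mem g r)%N].
  elim: k => [_|k IH ltko].
    exists [::], w; split; rewrite ?big_nil // (permP wt) count_cat count_nseq.
    by rewrite /= eqxx; lia.
  have [|v [r [wvr vk r1 cr]]] := IH; first exact: ltnW.
  have [|u [v' [t' [rE v'1 cv']]]] := pm g r.
    by apply: leq_ltn_trans cr; rewrite leq_pmull // subn_gt0.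
  exists (v' ++ v), (u ++ t'); split.
  - apply/permP => a; rewrite (permP wvr) rE -(addn1 k) nseqD.
    by rewrite !count_cat /= !count_cat /=; lia.
  - rewrite big_cat expgS /= vk; congr (_ * _).
    by move: v'1; rewrite big_cons => /mulg1_eq.
  - move: r1 v'1; rewrite rE !big_cat !big_cons big_cat /= => r1 gv'.
    by rewrite -[RHS]r1 (mulgA g) gv' mul1g.
  - move: cr cv'; rewrite rE -cat_cons !count_cat subnS.
    have : (0 < o - k)%N by rewrite subn_gt0.
    by case: (o - k)%N => // n _; rewrite [n.+1.-1]/= mulSn; lia.
have [//|v [r [wvr vo r1 _]]] := peel o.
exists (v ++ r); last by rewrite big_cat /= vo r1 expo mulg1.
rewrite -(perm_cat2l (nseq o g)) -(permPl wvr) (permPl wt).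
by rewrite addnC nseqD -catA.
Qed.

End Periodicity.

(** * Clifford and finitely generated commutative semigroups *)

Local Open Scope ring_scope.

(** Each element generates a cyclic group with identity [a *+ o]. *)
Lemma clifford_of_mulrn_eq (C : nmodType) o : (0 < o)%N ->
  (forall a : C, a *+ o.+1 = a) -> clifford C.
Proof.
move=> o_gt0 ao a.
have ao1 j : a *+ (j.+1 * o) = a *+ o.
  elim: j => [|j IH]; first by rewrite mul1n.
  rewrite mulSn mulrnDr IH -mulrnDr -{1}(prednK o_gt0) addSnnS mulrnDr ao.
  by rewrite -mulrSr prednK.
exists [set a *+ k.+1 | k in [set: nat]]; last by exists 0%N.
split.
  move=> _ _ [k _ <-] [l _ <-]; exists (k + l.+1)%N => //.
  by rewrite -mulrnDr.
exists (a *+ o); first by exists o.-1; rewrite ?prednK.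
move=> _ [k _ <-]; split.
  by rewrite mulrS addrA -mulrSr ao -mulrS.
exists (a *+ (k.+1 * o.-1 + o)).
  by exists (k.+1 * o.-1 + o.-1)%N => //; congr (_ *+ _); lia.
rewrite -mulrnDr -(ao1 k.+1); congr (_ *+ _); nia.
Qed.

(** Two multiples of [a] agree by finiteness, and inside a group that contains
    [a] the equation can be cancelled down to [a] itself. *)
Lemma clifford_finite_period (C : nmodType) (a : C) :
  clifford C -> finite_set [set: C] ->
  exists2 p, (0 < p)%N & forall k, a *+ (k * p).+1 = a.
Proof.
move=> /(_ a)[X [XD [e Xe eX]] Xa] /finite_pigeonhole[m pm].
have [i [j [ltij _ eqij]]] := pm (fun k => a *+ k).
have XaS k : X (a *+ k.+1).
  by elim: k => // k IH; rewrite mulrS; apply: XD.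
have [ea _] := eX a Xa; have [_ [y Xy yae]] := eX _ (XaS i).
have pe : a *+ (j - i) + e = e.
  rewrite -yae addrCA -mulrnDr; congr (_ + _).
  by rewrite addnS subnK ?(ltnW ltij) // !mulrS eqij.
exists (j - i)%N; first by rewrite subn_gt0.
elim=> [|k IH]; first by rewrite mul0n.
by rewrite mulSn -addnS mulrnDr IH -{2 3}ea addrA pe.
Qed.

(** A commutative monoid generated by finitely many elements with eventually
    periodic multiples is finite: [X] consists of the sums of reduced multiples
    of the elements of [r]. *)
Lemma finite_closed_of_periodic (C : nmodType) (r : seq C) :
  (forall a, a \in r -> exists L p, (0 < p)%N /\ a *+ (L + p) = a *+ L) ->
  exists X : set C, [/\ finite_set X, X 0 &
                        forall a x, a \in r -> X x -> X (a + x)].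
Proof.
elim: r => [|b r IH] per.
  by exists [set 0]; split=> //; apply: finite_set1.
have [a ar|X [finX X0 XD]] := IH; first by apply: per; rewrite in_cons ar orbT.
have [L [p [p_gt0 Lp]]] := per b (mem_head b r).
exists [set b *+ k + x | k in `I_(L + p) & x in X]; split.
- by apply: finite_image2 => //; apply: finite_II.
- by exists 0%N; [rewrite /=; lia|exists 0; rewrite // addr0].
move=> a _ /[swap] -[k ltk [x Xx <-]]; rewrite in_cons => /predU1P[->|ar].
  rewrite addrA -mulrS; have [->|neq] := eqVneq k.+1 (L + p)%N.
    by exists L; [rewrite /=; lia|exists x; rewrite ?Lp].
  by exists k.+1; [move: ltk neq => /=; lia|exists x].
by exists k => //; exists (a + x); [apply: XD|rewrite addrCA].
Qed.

(** * The free monoid is factorial *)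

Section Sequences.
Variable T : choiceType.
Implicit Types (S : {sequence T}) (x : T).

Lemma sequenceDE S S' x : (S + S') x = (S x + S' x)%N.
Proof. by rewrite /GRing.add /= msetE2. Qed.

Lemma sequence0E x : (0 : {sequence T}) x = 0%N.
Proof. exact: mset0E. Qed.

Lemma sequenceMnE S n x : (S *+ n) x = (n * S x)%N.
Proof.
by elim: n => [|n IH]; rewrite ?sequence0E // mulrS sequenceDE IH mulSn.
Qed.

Lemma perm_enumD S S' : perm_eq (S + S' : {sequence T}) (S ++ S').
Proof.
apply/allP => x _ /=; rewrite count_cat !count_mem_mset; exact/eqP/sequenceDE.
Qed.

Lemma perm_enumMn S n : perm_eq (S *+ n : {sequence T}) (copies n S).
Proof.
apply/allP => x _ /=; rewrite count_copies !count_mem_mset.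
exact/eqP/sequenceMnE.
Qed.

Lemma sequence_cons x (s : seq T) :
  seq_mset (x :: s) = seq_mset [:: x] + seq_mset s.
Proof.
by apply/msetP => y; rewrite sequenceDE !mset_seqE /= addn0.
Qed.

Lemma sequence_sum (s : seq T) : \sum_(x <- s) seq_mset [:: x] = seq_mset s.
Proof.
elim: s => [|x s IH]; last by rewrite big_cons IH -sequence_cons.
by rewrite big_nil; apply/msetP => y; rewrite sequence0E mset_seqE.
Qed.

Lemma sequence_units S : units {sequence T} S -> S = 0.
Proof.
case=> S' /msetP SS'; apply/msetP => x; have := SS' x.
by rewrite sequenceDE !sequence0E; lia.
Qed.

Lemma sequence_associated S S' : associated S S' -> S' = S.
Proof. by case=> u /sequence_units-> ->; rewrite addr0. Qed.

Lemma units0 : units {sequence T} 0.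
Proof. by exists 0; rewrite addr0. Qed.

Lemma irreducible_sequence S : irreducible S -> exists x, S = seq_mset [:: x].
Proof.
move=> [Snu irrS]; have [S0|[x xS]] := mset_0Vmem S.
  by case: Snu; rewrite S0; apply: units0.
have SE : S = seq_mset [:: x] + (S `\ x)%mset.
  apply/msetP => y; rewrite sequenceDE mset_seqE /= msetB1E eq_sym addn0.
  by have [->|] := eqVneq y x; move: xS; rewrite in_mset; lia.
have [/sequence_units x0|/sequence_units Sx0] := irrS _ _ SE.
  have := sequence0E x; rewrite -x0 mset_seqE /= eqxx.
  by [].
by exists x; rewrite SE Sx0 addr0.
Qed.

Lemma irreducible_singleton x : irreducible (seq_mset [:: x]).
Proof.
split=> [/sequence_units/msetP/(_ x)|S S' /msetP xSS'].
  by rewrite sequence0E mset_seqE /= eqxx.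
have xE y : (S y + S' y)%N = (x == y).
  by rewrite -sequenceDE -xSS' mset_seqE /= addn0.
have [Sx0|Sx0] := eqVneq (S x) 0%N; [left|right].
  suff -> : S = 0 by apply: units0.
  apply/msetP => y; rewrite sequence0E; have := xE y.
  by have [<-|] := eqVneq x y => [|_] /=; lia.
suff -> : S' = 0 by apply: units0.
apply/msetP => y; rewrite sequence0E; have := xE y.
by have [<-|] := eqVneq x y => [|_] /=; lia.
Qed.

Lemma factorization_sequence (s : seq {sequence T}) S :
  factorization s S -> perm_eq s [seq seq_mset [:: x] | x <- S].
Proof.
case=> irrs /sequence_associated ->.
have [s' ->] : exists s', s = [seq seq_mset [:: x] | x <- s'].
  elim: s irrs => [|a s IH] irrs; first by exists [::].
  have [x ->] := irreducible_sequence (irrs a (mem_head a s)).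
  have [b bs|s' ->] := IH; first by apply: irrs; rewrite in_cons bs orbT.
  by exists (x :: s').
by rewrite big_map sequence_sum perm_map // perm_sym perm_eq_seq_mset.
Qed.

Lemma sequence_factorial : factorial_monoid {sequence T}.
Proof.
split=> [S|S s t /factorization_sequence sS /factorization_sequence tS].
  exists [seq seq_mset [:: x] | x <- (S : {sequence T})]; split.
    by move=> _ /mapP[x _ ->]; apply: irreducible_singleton.
  exists 0; first exact: units0.
  by rewrite big_map sequence_sum seq_mset_id addr0.
exists s; split=> //; first by rewrite (permPl tS) perm_sym.
by move=> i _; exists 0; [apply: units0|rewrite addr0].
Qed.

End Sequences.

(** * Sequences coloured by a finite group *)

Section Colouring.
Variables (T : choiceType) (Q : groupType) (col : T -> Q) (lift : Q -> T).
Hypotheses (liftK : cancel lift col) (finQ : finite_set [set: Q]).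
Variable H : set {sequence T}.
Hypothesis HE : forall S : {sequence T}, H S <-> product_one [seq col x | x <- S].
Implicit Types (S : {sequence T}) (x : T) (s t : seq Q).

Local Notation class := (\pi_(class_semigroup H)).

Lemma product_one_permE s t : perm_eq s t -> product_one s <-> product_one t.
Proof.
by move=> st; split; apply: product_one_perm; rewrite // perm_sym.
Qed.

Lemma colourD S S' :
  H (S + S') <-> product_one ([seq col x | x <- S] ++ [seq col x | x <- S']).
Proof.
by rewrite HE -map_cat; apply/product_one_permE/perm_map/perm_enumD.
Qed.

Lemma map_copies U V (f : U -> V) n (s : seq U) :
  map f (copies n s) = copies n (map f s).
Proof. by rewrite map_flatten map_nseq. Qed.

Lemma colourMnD S n S' :
  H (S *+ n + S') <->
  product_one (copies n [seq col x | x <- S] ++ [seq col x | x <- S']).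
Proof.
rewrite colourD; apply/product_one_permE; rewrite perm_cat2r -map_copies.
exact/perm_map/perm_enumMn.
Qed.

Lemma colourMn S n : H (S *+ n) <-> product_one (copies n [seq col x | x <- S]).
Proof.
rewrite HE -map_copies; exact/product_one_permE/perm_map/perm_enumMn.
Qed.

Lemma classD S S' : class (S + S') = class S + class S'.
Proof. by rewrite -cs_addE. Qed.

Lemma classMn S n : class (S *+ n) = class S *+ n.
Proof. by elim: n => [|n IH] //; rewrite !mulrS classD IH. Qed.

Lemma class_clifford : unique_commutator Q -> clifford (class_semigroup H).
Proof.
move=> UQ; have [o o_gt0 expo] := finite_group_exponent finQ.
apply: (clifford_of_mulrn_eq o_gt0); elim/quotW=> S; rewrite -classMn.
apply/cs_eqP => S'; rewrite colourMnD colourD.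
exact: product_one_copies.
Qed.

Lemma class_singleton x :
  class (seq_mset [:: x]) = class (seq_mset [:: lift (col x)]).
Proof.
apply/cs_eqP => S; rewrite !colourD; apply/product_one_permE.
rewrite perm_cat2r.
have seq1 y : [seq col z | z <- seq_mset [:: y]] = [:: col y].
  apply: perm_small_eq => //; exact: (perm_map col (perm_eq_seq_mset [:: y])).
by rewrite !seq1 liftK.
Qed.

(** The class of a letter depends only on its colour ([class_singleton]), so
    finitely many classes of letters generate the class semigroup. *)
Lemma class_finite : finite_set [set: class_semigroup H].
Proof.
have /finite_seqP[r rE] := finQ.
pose g q := class (seq_mset [:: lift q]).
have [L [p [p_gt0 Lp]]] := product_one_periodic finQ.
have [|X [finX X0 XD]] := @finite_closed_of_periodic _ [seq g q | q <- r].
  move=> _ /mapP[q _ ->]; exists L, p; split=> //; rewrite -!classMn.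
  have colq : perm_eq [seq col z | z <- seq_mset [:: lift q]] [:: q].
    by rewrite -{2}(liftK q); apply: (perm_map col (perm_eq_seq_mset _)).
  have copq n : perm_eq (copies n [seq col z | z <- seq_mset [:: lift q]])
                        (nseq n q).
    apply/permP=> a; rewrite count_copies (permP colq) count_nseq /= addn0.
    by rewrite mulnC.
  have copE n t :
      product_one (copies n [seq col z | z <- seq_mset [:: lift q]] ++ t) <->
      product_one (nseq n q ++ t).
    by apply: product_one_permE; rewrite perm_cat2r.
  by apply/cs_eqP => S; rewrite !colourMnD !copE.
apply: (sub_finite_set _ finX); elim/quotW=> S _.
suff XS (s : seq T) : X (class (seq_mset s)) by rewrite -(seq_mset_id S).
elim: s => [|x s IH].
  by rewrite (_ : seq_mset [::] = 0) // -(sequence_sum [::]) big_nil.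
rewrite sequence_cons classD class_singleton; apply: XD => //.
by apply/map_f; have : [set: Q] (col x) by []; rewrite rE.
Qed.

Lemma clifford_root_closed : clifford (class_semigroup H) ->
  forall S, (exists N, forall n, (N <= n)%N -> H (S *+ n)) -> H S.
Proof.
move=> cliff S [N SN].
have [p p_gt0 pS] := clifford_finite_period (class S) cliff class_finite.
have := pS N; rewrite -classMn => /cs_eqP/(_ 0); rewrite !addr0 => <-.
by apply: SN; nia.
Qed.

Lemma root_closed_seminormal_lists :
  (forall S, (exists N, forall n, (N <= n)%N -> H (S *+ n)) -> H S) <->
  seminormal_lists Q.
Proof.
split=> [HS s [N sN]|SN S [N SHN]].
  have seqE : perm_eq [seq col x | x <- seq_mset (map lift s)] s.
    have := perm_map col (perm_eq_seq_mset (map lift s)).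
    by rewrite -map_comp (eq_map (g := id)) ?map_id.
  apply: (product_one_perm seqE); apply/HE/HS; exists N => n leNn.
  apply/colourMn; apply: product_one_perm (sN n leNn).
  by apply/permP=> a; rewrite !count_copies (permP seqE).
by apply/HE/SN; exists N => n leNn; apply/colourMn/SHN.
Qed.

End Colouring.

(** * The monoid of product-[K] sequences *)

Lemma cancel_addIr (H : cancelNmodType) (x y z : H) : y + x = z + x -> y = z.
Proof. by rewrite !(addrC _ x) => /cancel_addI. Qed.

Lemma fractionMn (H : cancelNmodType) (p : H * H) n :
  \pi_(fraction_group H) p *+ n = \pi_(fraction_group H) (p.1 *+ n, p.2 *+ n).
Proof.
elim: n => [|n IH] //; rewrite !mulrS IH.
exact: fg_addE.
Qed.

Lemma perm_map_exists (T : eqType) (U : eqType) (f : T -> U) t s :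
  perm_eq t (map f s) -> exists2 s', perm_eq s' s & t = map f s'.
Proof.
elim: t s => [|u t IH] s.
  by rewrite perm_sym => /perm_nilP; case: s => // _; exists [::].
move=> us; have : u \in map f s by rewrite -(perm_mem us) mem_head.
case/mapP=> x xs uE; have sE := perm_to_rem xs.
have [|s' s'E ->] := IH (rem x s).
  by rewrite -(perm_cons u) (permPl us) uE -(map_cons f); apply: perm_map.
by exists (x :: s'); rewrite ?uE // (permPr sE) perm_cons.
Qed.

Section NormalSubgroup.
Variables (G : groupType) (K : normalClosed G) (Q : groupType).
Variables (col : G -> Q) (lift : Q -> G).
Hypotheses (liftK : cancel lift col) (finQ : finite_set [set: Q]).
Hypothesis colM : {morph col : x y / (x * y)%g}.
Hypothesis colK : forall x, col x = 1%g <-> x \in K.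

Lemma product_seqE (S : {sequence G}) :
  S \in product_seq K <-> product_one [seq col x | x <- S].
Proof.
have col1 : col 1%g = 1%g by apply/colK/gpred1.
have col_prod (s : seq G) :
    col (\prod_(x <- s) x)%g = (\prod_(x <- map col s) x)%g.
  by rewrite big_map (big_morph col colM col1).
split=> [/asboolP[_ [[s sS <-]]]|[t /perm_map_exists[s sS ->] s1]].
  by move=> /colK; rewrite col_prod; exists (map col s); rewrite ?perm_map.
by apply/asboolP; exists (\prod_(x <- s) x)%g; split;
  [exists s | apply/colK; rewrite col_prod].
Qed.

Let root_closed := root_closed_seminormal_lists liftK product_seqE.

Lemma product_class_clifford :
  clifford (product_class_semigroup K) <-> seminormal_lists Q.
Proof.
split=> [cliff|SN].
  exact/root_closed/(clifford_root_closed liftK finQ product_seqE).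
by apply: (class_clifford finQ product_seqE);
  apply: seminormal_lists_unique_commutator.
Qed.

Lemma product_monoid_C : C_monoid (product_monoid K).
Proof.
exists {sequence G}, (val : {additive product_monoid K -> {sequence G}}).
have rangeE S : range (val : product_monoid K -> {sequence G}) S <->
    product_one [seq col x | x <- S].
  split=> [[y _ <-]|/product_seqE KS]; first exact/product_seqE/valP.
  by exists (exist _ S KS).
split.
- exact: sequence_factorial.
- exact: val_inj.
- apply/seteqP; split=> [_ [[y _ <-] /sequence_units y0]|_ [y [z yz] <-]].
    exists y => //; exists 0; apply: val_inj.
    by rewrite addr0 y0 raddf0.
  by split; [exists y|exists (val z); rewrite -raddfD yz raddf0].
- exact: sub_finite_set (class_finite liftK finQ rangeE).
Qed.

Let H := product_monoid K.

Let valMn (y : H) n : val (y *+ n) = val y *+ n.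
Proof. exact: (raddfMn (val : {additive H -> {sequence G}})). Qed.

Let fraction_eqP (p q : H * H) :
  \pi_(fraction_group H) p = \pi_(fraction_group H) q <->
  val p.1 + val q.2 = val q.1 + val p.2.
Proof.
by split=> [/fg_eqP/eqP/(congr1 val)|pq]; last exact/fg_eqP/eqP/val_inj.
Qed.

(** A sequence [S] with large multiples in the monoid is the fraction
    [((N + 1) S) / (N S)]. Conversely, if a positive multiple of a fraction [A / B]
    is a sequence, then [B] divides [A], so that the fraction is a sequence. *)
Lemma product_monoid_seminormal :
  seminormal (product_monoid K) <-> seminormal_lists Q.
Proof.
apply: iff_trans root_closed; split=> [SN S [N SN']|KS].
  pose A : H := exist _ (S *+ N.+1) (SN' _ (leqnSn N)).
  pose B : H := exist _ (S *+ N) (SN' _ (leqnn N)).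
  have : seminormal_closure (\pi_(fraction_group H) (A, B)).
    exists N => n leNn; exists (exist _ (S *+ n) (SN' n leNn)) => //.
    rewrite fractionMn; apply/fraction_eqP; rewrite !valMn addr0 /=.
    by rewrite -!mulrnA -mulrnDr; congr (_ *+ _); lia.
  rewrite SN => -[y _ /fraction_eqP/=]; rewrite addr0 mulrS => yS.
  by rewrite -(cancel_addIr yS); apply: valP y.
apply/seteqP; split=> [x|_ [y _ <-]]; last first.
  by exists 0%N => n _; exists (y *+ n) => //; rewrite fractionMn mul0rn.
elim/quotW: x => -[A B] [N ABN].
have ABn n : (N <= n)%N ->
    exists2 S, S \in product_seq K & S + val B *+ n = val A *+ n.
  move=> /ABN[y _]; rewrite fractionMn => /fraction_eqP/=.
  by rewrite !valMn addr0 => <-; exists (val y) => //; apply: valP.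
pose S : {sequence G} := (val A `\` val B)%mset.
have AE : val A = S + val B.
  apply/msetP=> g; rewrite sequenceDE msetE2 subnK //.
  have [S' _ /msetP/(_ g)] := ABn N.+1 (leqnSn N).
  rewrite sequenceDE !sequenceMnE => /esym.
  by rewrite -(leq_pmul2l (ltn0Sn N)) => ->; rewrite leq_addl.
have KS' : S \in product_seq K.
  apply: KS; exists N => n /ABn[S' KS'].
  by rewrite AE mulrnDl => S'E; rewrite -(cancel_addIr S'E).
exists (exist _ S KS') => //; apply/fraction_eqP => /=.
by rewrite AE addr0.
Qed.

End NormalSubgroup.

(** * The equivalences *)

Lemma card_le2 (T : eqType) (A : set T) x y z : A #<= `I_2 ->
  A x -> A y -> A z -> x != y -> x != z -> y = z.
Proof.
case/pcard_leP=> f Ax Ay Az xy xz.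
have f_lt2 t : A t -> (f t < 2)%N by move=> At; apply: (@funS _ _ _ _ f).
have f_inj t u : A t -> A u -> f t = f u -> t = u.
  by move=> At Au; apply: (@inj _ _ _ f); rewrite inE.
have fxy : f x != f y by apply: contra_neq xy; apply: f_inj.
have fxz : f x != f z by apply: contra_neq xz; apply: f_inj.
apply: f_inj => //.
have := f_lt2 x Ax; have := f_lt2 y Ay; have := f_lt2 z Az; lia.
Qed.

Lemma unique_commutatorP (Q : groupType) :
  unique_commutator Q <-> commutator_subgroup Q #<= `I_2.
Proof.
split=> [|c2 a b c d ab1 cd1]; first exact: commutator_subgroup_card.
have commP x y : commutator_subgroup Q [~ x, y]%g.
  by apply: sub_gen_smallest; exists x, y.
have comm1 : commutator_subgroup Q 1%g by rewrite -(commg1 1%g).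
by apply: (card_le2 c2 comm1); rewrite // eq_sym.
Qed.

(** The passage from uniqueness to seminormality goes through the class semigroup
    of the product-one sequences over [Q] itself. *)
Lemma seminormal_listsP (Q : groupType) : finite_set [set: Q] ->
  seminormal_lists Q <-> unique_commutator Q.
Proof.
move=> finQ; split; first exact: seminormal_lists_unique_commutator.
pose H : set {sequence Q} := [set S | product_one [seq id x | x <- S]].
have HE (S : {sequence Q}) : H S <-> product_one [seq id x | x <- S] by [].
have idK : cancel (@id Q) id by [].
move/(class_clifford finQ HE)/(clifford_root_closed idK finQ HE).
by move/(root_closed_seminormal_lists idK HE).
Qed.

Theorem corollary3p5 (G : groupType) (K : normalClosed G)
    (finGK : finite_set [set: quotient_group K]) :
  [<-> seminormal (product_monoid K) /\ C_monoid (product_monoid K);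
       clifford (product_class_semigroup K);
       clifford (product_one_class_semigroup (quotient_group K));
       seminormal (product_one_monoid (quotient_group K)) /\
         C_monoid (product_one_monoid (quotient_group K));
       commutator_subgroup (quotient_group K) #<= `I_2].
Proof.
pose Q : groupType := quotient_group K.
pose proj (x : G) : Q := \pi_(quotient_group K) x.
pose lift (q : Q) : G := repr q.
have projK : cancel lift proj by move=> q; apply: reprK.
have projM : {morph proj : x y / (x * y)%g} by move=> x y; apply/esym/qg_mulE.
have proj1 x : proj x = 1%g <-> x \in K.
  split=> [/esym/qg_eqP|xK]; first by rewrite invg1 mul1g.
  by apply/esym/qg_eqP; rewrite invg1 mul1g.
have idK : cancel (@id Q) id by [].
have idM : {morph (@id Q) : x y / (x * y)%g} by [].
have id1 (x : Q) : x = 1%g <-> x \in one_pred Q by split=> [->|/eqP//]; apply/eqP.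
have [bS Sb] := product_class_clifford projK finGK projM proj1.
have [cS Sc] := product_class_clifford idK finGK idM id1.
have [aS Sa] := product_monoid_seminormal projK projM proj1.
have [dS Sd] := product_monoid_seminormal idK idM id1.
have aC := product_monoid_C projK finGK projM proj1.
have dC := product_monoid_C idK finGK idM id1.
have SE := seminormal_listsP finGK.
split; first by case=> /aS/Sb.
split; first by move/bS/Sc.
split; first by move/cS/Sd.
split; first by case=> /dS/SE/unique_commutatorP.
by move/unique_commutatorP/SE/Sa.
Qed.
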